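(* Let $M$ be a finite-dimensional smooth manifold, let $g,\widetilde{g}$ be two Riemannian metrics on $M$, and let $J$ be the unique tensor field of type $(1,1)$ on $M$ such that $\widetilde{g}(X,Y)=g(X,JY)=g(JX,Y)$ for all $X,Y\in\mathcal{X}(M)$. Let $\nabla,\widetilde{\nabla}$ be the Levi-Civita connections of $g,\widetilde{g}$ and let $A=\widetilde{\nabla}-\nabla$. Suppose that $J$ is $\nabla$-recurrent, i.e. there exists $\omega\in\Omega^1(M)$ such that $\nabla_XJ=\omega(X)J$ for all $X\in\mathcal{X}(M)$. Then $(M,\widetilde{g},A)$ is a formal Frobenius structure if and only if for all $X,Y,Z\in\mathcal{X}(M)$ $$\omega(X)g(Y,Z)=\omega(Z)g(Y,X).$$
   Context: $\mathcal{X}(M)$ denotes the smooth vector fields on $M$ and $\Omega^1(M)$ the smooth $1$-forms. For a Riemannian metric $h$ on $M$ and a tensor field $A$ of type $(1,2)$, the triple $(M,h,A)$ is called a formal Frobenius structure if (i) $h(A(X,Y),Z)=h(X,A(Y,Z))$ for all $X,Y,Z\in\mathcal{X}(M)$, and (ii) $A(X,Y)=A(Y,X)$ for all $X,Y\in\mathcal{X}(M)$. The difference of connections is $A(X,Y)=\widetilde{\nabla}_XY-\nabla_XY$. *)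

(* Defs.v *)
From HB Require Import structures.
From mathcomp Require Import all_boot all_order all_algebra.
From mathcomp Require Import all_classical all_reals all_analysis.

Set Implicit Arguments.
Unset Strict Implicit.
Unset Printing Implicit Defensive.

Import Order.TTheory GRing.Theory Num.Theory.
Import numFieldNormedType.Exports.

Local Open Scope classical_set_scope.
Local Open Scope ring_scope.

(* Meant for [U] open; by [Ck_ext] only the values of [f] on [U] then matter. *)
Fixpoint Ck (R : realType) (V W : normedModType R) (k : nat) (U : set V)
    (f : V -> W) : Prop :=
  if k is k'.+1 then
    (forall x, U x -> differentiable f x) /\ (forall v, Ck k' U ('D_v f))
  else forall x, U x -> {for x, continuous f}.

Definition smooth_on (R : realType) (V W : normedModType R) (U : set V)
  (f : V -> W) : Prop := forall k, Ck k U f.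

Section CkTheory.
Context {R : realType} {V W : normedModType R}.
Implicit Types (U : set V).

Lemma near_eq_differentiable (f g : V -> W) x :
  {near x, f =1 g} -> differentiable f x -> differentiable g x.
Proof.
move=> fg df; have -> : g = f + (g - f) by rewrite addrC subrK.
apply: differentiableD => //; set h := g - f.
have hx0 : h x = 0 by rewrite /h !fctE (nbhs_singleton fg) subrr.
have H : h \o shift x = cst (h x) + (\0 : {linear V -> W}) +o_ 0 (id : V -> V).
  apply/eqaddoP => e e0; rewrite hx0.
  have := fg; rewrite (near_shift 0) => fg0.
  near=> y; rewrite !fctE /= !addr0 subr0.
  have fgy : f (y + x) = g (y + x).
    have -> : y + x = shift (x - 0) y by rewrite /= subr0.
    by near: y.
  by rewrite /h !fctE fgy subrr normr0 mulr_ge0 // ltW.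
have c0 : continuous (\0 : {linear V -> W}) by move=> y; exact: cvg_cst.
by apply/diff_locallyP; rewrite (diff_unique c0 H).
Unshelve. all: by end_near. Qed.

Lemma Ck_ext k U (f g : V -> W) : open U -> (forall x, U x -> f x = g x) ->
  Ck k U f -> Ck k U g.
Proof.
move=> oU; elim: k f g => [|k IH] f g fg /=; have nfg x : U x -> {near x, f =1 g}.
- by move=> Ux; near=> y; apply: fg; near: y; exact: open_nbhs_nbhs.
- move=> cf x Ux; rewrite /prop_for /continuous_at -(fg _ Ux).
  by apply: cvg_trans (cf _ Ux); exact/near_eq_cvg/nfg.
- by move=> Ux; near=> y; apply: fg; near: y; exact: open_nbhs_nbhs.
- move=> [df Df]; split=> [x Ux|v].
    exact: near_eq_differentiable (nfg _ Ux) (df _ Ux).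
  by apply: IH (Df v) => x Ux; apply: near_eq_derive; exact: nfg.
Unshelve. all: by end_near. Qed.

Lemma CkS k U (f : V -> W) : Ck k.+1 U f -> Ck k U f.
Proof.
elim: k f => [|k IH] f /= [df Df].
  by move=> x Ux; exact: differentiable_continuous (df _ Ux).
by split=> // v; apply: IH; exact: Df.
Qed.

Lemma Ck_cst k U (a : W) : Ck k U (cst a : V -> W).
Proof.
elim: k a => [|k IH] a /=; first by move=> x _; exact: cst_continuous.
split=> [x _|v]; first exact: differentiable_cst.
have -> : 'D_v (cst a : V -> W) = cst 0 by apply/funext => x; rewrite derive_cst.
exact: IH.
Qed.

Lemma CkD k U (f g : V -> W) : open U -> Ck k U f -> Ck k U g -> Ck k U (f + g).
Proof.
move=> oU; elim: k f g => [|k IH] f g /=.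
  by move=> cf cg x Ux; apply: continuousD; [exact: cf|exact: cg].
move=> [df Df] [dg Dg]; split=> [x Ux|v].
  by apply: differentiableD; [exact: df|exact: dg].
apply: Ck_ext (IH _ _ (Df v) (Dg v)) => // x Ux; rewrite deriveD //.
- exact/diff_derivable/df.
- exact/diff_derivable/dg.
Qed.

End CkTheory.

Lemma CkM (R : realType) (V : normedModType R) k (U : set V) (f g : V -> R) :
  open U -> Ck k U f -> Ck k U g -> Ck k U (f * g).
Proof.
move=> oU; elim: k f g => [|k IH] f g.
  by move=> cf cg x Ux; apply: continuousM; [exact: cf|exact: cg].
move=> Cf Cg; have [[df Df] [dg Dg]] := (Cf, Cg); split=> [x Ux|v].
  by apply: differentiableM; [exact: df|exact: dg].
apply: Ck_ext (CkD oU (IH _ _ (CkS Cf) (Dg v)) (IH _ _ (CkS Cg) (Df v))) => //.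
move=> x Ux; rewrite deriveM //.
- exact/diff_derivable/df.
- exact/diff_derivable/dg.
Qed.

Record chart (R : realType) (n : nat) (M : topologicalType) := Chart {
  chart_dom : set M;
  chart_map : M -> 'rV[R]_n;
  chart_inv : 'rV[R]_n -> M;
  chart_dom_open : open chart_dom;
  chart_codom_open : open (chart_map @` chart_dom);
  chart_mapK : forall p, chart_dom p -> chart_inv (chart_map p) = p;
  chart_map_continuous : {within chart_dom, continuous chart_map};
  chart_inv_continuous :
    {within chart_map @` chart_dom, continuous chart_inv} }.

Arguments chart_dom_open {R n M} c.
Arguments chart_codom_open {R n M} c.

(* Smooth manifolds of dimension [n]; the smooth structure is given by an atlas,
   not necessarily maximal. *)
Record smoothManifold (R : realType) (n : nat) := SmoothManifold {
  manifold_space :> topologicalType;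
  manifold_hausdorff : hausdorff_space manifold_space;
  manifold_second_countable : @second_countable manifold_space;
  atlas : set (chart R n manifold_space);
  atlas_cover : forall p, exists2 c, atlas c & chart_dom c p;
  atlas_compatible : forall c c', atlas c -> atlas c' ->
    smooth_on (chart_map c @` (chart_dom c `&` chart_dom c'))
      (chart_map c' \o chart_inv c) }.

Definition smooth (R : realType) (n : nat) (M : smoothManifold R n)
    (f : M -> R) : Prop :=
  forall c, atlas c -> smooth_on (chart_map c @` chart_dom c) (f \o chart_inv c).

(* The commutative ring C^oo(M); it is the zero ring when M is empty. *)
Section SmoothFunctions.
Variables (R : realType) (n : nat) (M : smoothManifold R n).

Definition smooth_pred : {pred M -> R} := [pred f | `[< smooth f >]].

Lemma smooth_predP f : reflect (smooth f) (f \in smooth_pred).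
Proof. by rewrite inE; exact: asboolP. Qed.

Lemma smooth_subring_closed : subring_closed smooth_pred.
Proof.
have N1 k (U : set 'rV[R]_n) (a : R) : Ck k U (cst a) by exact: Ck_cst.
have MM (f g : M -> R) : f \in smooth_pred -> g \in smooth_pred ->
    f * g \in smooth_pred.
  move=> /smooth_predP sf /smooth_predP sg; apply/smooth_predP => c ac k.
  exact: (CkM (chart_codom_open c) (sf _ ac k) (sg _ ac k)).
have cP a : (cst a : M -> R) \in smooth_pred.
  by apply/smooth_predP => c ac k; exact: N1.
split=> //; first exact: (cP 1).
move=> f g sf sg; have : (cst (-1) : M -> R) * g \in smooth_pred by exact: MM.
move: sf => /smooth_predP sf /smooth_predP sNg; apply/smooth_predP => c ac k.
have := CkD (chart_codom_open c) (sf _ ac k) (sNg _ ac k).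
by congr (Ck k _ _); apply/funext => x; rewrite !fctE /= mulN1r.
Qed.

HB.instance Definition _ :=
  GRing.isSubringClosed.Build (M -> R) smooth_pred smooth_subring_closed.

Record smoothFun := SmoothFun {
  smoothFun_val :> M -> R;
  smoothFun_smooth : smoothFun_val \in smooth_pred }.

HB.instance Definition _ := [isSub for smoothFun_val].
HB.instance Definition _ := [Choice of smoothFun by <:].
HB.instance Definition _ := GRing.SubChoice_isSubComPzRing.Build
  (M -> R) smooth_pred smoothFun (GRing.subringClosedP smooth_pred).

Lemma smooth_cst (a : R) : (cst a : M -> R) \in smooth_pred.
Proof. by apply/smooth_predP => c ac k; exact: Ck_cst. Qed.

Definition smoothFun_cst (a : R) : smoothFun := SmoothFun (smooth_cst a).

End SmoothFunctions.

(* The C^oo(M)-module X(M): vector fields are the derivations of the R-algebra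
   C^oo(M), so [X f] is the derivative of [f] along [X]. *)
Section VectorFields.
Variables (R : realType) (n : nat) (M : smoothManifold R n).
Local Notation C := (smoothFun M).

Definition derivation (D : C -> C) : Prop :=
  [/\ forall f g, D (f + g) = D f + D g,
      forall a f, D (smoothFun_cst M a * f) = smoothFun_cst M a * D f &
      forall f g, D (f * g) = f * D g + g * D f].

(* [C^o] is [C] seen as a module over itself. *)
Definition derivation_pred : {pred C -> C^o} := [pred D | `[< derivation D >]].

Lemma derivation_predP D : reflect (derivation D) (D \in derivation_pred).
Proof. by rewrite inE; exact: asboolP. Qed.

Lemma derivation_submod_closed : submod_closed derivation_pred.
Proof.
split=> [|f D E].
  apply/derivation_predP; split=> *; rewrite -[LHS]/(0 : C).
  - by rewrite -[RHS]/(0 + 0 : C) addr0.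
  - by rewrite -[RHS]/(_ * 0 : C) mulr0.
  - by rewrite -[RHS]/(_ * 0 + _ * 0 : C) !mulr0 addr0.
move=> /derivation_predP [DD DR DM] /derivation_predP [ED ER EM].
have fE x : (f *: D + E) x = f * D x + E x :> C by [].
apply/derivation_predP; split=> *; rewrite !fE.
- by rewrite DD ED mulrDr addrACA.
- by rewrite DR ER mulrDr mulrCA.
- by rewrite DM EM !mulrDr addrACA; congr (_ + _ + _); rewrite mulrCA.
Qed.

HB.instance Definition _ :=
  GRing.isSubmodClosed.Build C (C -> C^o) derivation_pred
    derivation_submod_closed.

Record vectorField := VectorField {
  vectorField_val :> C -> C^o;
  vectorField_derivation : vectorField_val \in derivation_pred }.

HB.instance Definition _ := [isSub for vectorField_val].
HB.instance Definition _ := [Choice of vectorField by <:].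
HB.instance Definition _ := [SubChoice_isSubLmodule of vectorField by <:].

Definition lie_bracket_val (X Y : vectorField) : C -> C^o :=
  fun f => X (Y f) - Y (X f).

Lemma lie_bracket_derivation X Y : lie_bracket_val X Y \in derivation_pred.
Proof.
have := vectorField_derivation X; have := vectorField_derivation Y => /derivation_predP [YD YR YM] /derivation_predP [XD XR XM]; apply/derivation_predP.
split=> *; rewrite /lie_bracket_val.
- by rewrite YD XD XD YD opprD addrACA.
- by rewrite YR XR XR YR mulrBr.
- rewrite YM XM XD YD !XM !YM !mulrBr !opprD.
  rewrite [Y _ * X _]mulrC [Y _ * X _]mulrC.
  rewrite [LHS](AC ((2*2)*(2*2)) ((1*5)*(3*7)*(2*8)*(4*6))) /=.
  by rewrite !subrr !addr0.
Qed.

Definition lie_bracket (X Y : vectorField) : vectorField :=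
  VectorField (lie_bracket_derivation X Y).

(* The tangent vector X_p, as a derivation at p. *)
Definition tangent_at (X : vectorField) (p : M) : C -> R := fun f => X f p.

End VectorFields.

(* A tensor field with values in functions or vector fields is a
   C^oo(M)-multilinear map on X(M): 1-forms are [{scalar vectorField M}], fields
   of type (1,1) are [{linear vectorField M -> vectorField M}], and fields of
   type (0,2) and (1,2) are the C^oo(M)-bilinear maps below. *)
Section Tensors.
Variables (R : realType) (n : nat) (M : smoothManifold R n).
Local Notation C := (smoothFun M).
Local Notation X := (vectorField M).

Definition tensor2 (W : lmodType C) (A : X -> X -> W) : Prop :=
  (forall x, linear (A x)) /\ (forall y, linear (A ^~ y)).

Record riemannianMetric := RiemannianMetric {
  riemannian_val :> X -> X -> C;
  riemannian_tensor : @tensor2 C^o riemannian_val;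
  riemannian_sym : forall x y, riemannian_val x y = riemannian_val y x;
  riemannian_pos : forall x p, tangent_at x p != 0 -> 0 < riemannian_val x x p }.

(* R-linearity in the second argument is the Leibniz rule for constant [f]. *)
Record affineConnection := AffineConnection {
  nabla :> X -> X -> X;
  nabla_linear : forall y, linear (nabla ^~ y);
  nablaD : forall x y z, nabla x (y + z) = nabla x y + nabla x z;
  nabla_leibniz : forall x (f : C) y,
    nabla x (f *: y) = (x f : C) *: y + f *: nabla x y }.

Definition torsion_free (D : affineConnection) : Prop :=
  forall x y, D x y - D y x = lie_bracket x y.

Definition metric_compatible (g : riemannianMetric) (D : affineConnection)
    : Prop :=
  forall x y z : X, x (g y z) = g (D x y) z + g y (D x z).

Definition levi_civita (g : riemannianMetric) (D : affineConnection) : Prop :=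
  torsion_free D /\ metric_compatible g D.

(* (nabla_x J) y *)
Definition nabla_endo (D : affineConnection) (J : {linear X -> X}) (x y : X)
  : X := D x (J y) - J (D x y).

Definition recurrent_with (D : affineConnection) (J : {linear X -> X})
    (w : {scalar X}) : Prop :=
  forall x y, nabla_endo D J x y = w x *: J y.

Definition connection_diff (D' D : affineConnection) (x y : X) : X :=
  D' x y - D x y.

Definition formal_frobenius (h : riemannianMetric) (A : X -> X -> X) : Prop :=
  [/\ tensor2 A,
      forall x y z, h (A x y) z = h x (A y z) &
      forall x y, A x y = A y x].

End Tensors.

(* Main.v *)
(** Recurrence of [J] says [∇_X g' = w(X) g'], so Koszul's trick gives
    [2 g'(A(X,Y),Z) = w(X) g'(Y,Z) + w(Y) g'(X,Z) - w(Z) g'(X,Y)].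
    Hence [(M, g', A)] is Frobenius iff [g'(Y, w(X) Z - w(Z) X) = 0] for all
    [X, Y, Z]. Taking [Y := w(X) Z - w(Z) X], definiteness of [g'] turns this into
    [w(X) Z = w(Z) X], a condition that no longer involves the metric; thus
    [g'] may be replaced by [g] without inverting [J]. *)

Require Import Defs.
From mathcomp Require Import all_boot all_order all_algebra.
From mathcomp Require Import all_classical all_reals all_analysis.
From mathcomp Require Import ring lra.

Set Implicit Arguments.
Unset Strict Implicit.
Unset Printing Implicit Defensive.

Import Order.TTheory GRing.Theory Num.Theory.
Local Open Scope ring_scope.

Section Metrics.
Variables (R : realType) (n : nat) (M : smoothManifold R n).
Local Notation C := (smoothFun M).
Implicit Types (h : riemannianMetric M) (X Y Z : vectorField M) (f : C).

(** Removes the factor 2 of Koszul's formula: [C] is only given a ring structure, so the division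
    takes place in [R], point by point. *)
Lemma smoothFun_mulr2_inj f f' : f + f = f' + f' -> f = f'.
Proof.
move=> ff'; apply/val_inj/funext => p.
have double_inj (a b : R) : a + a = b + b -> a = b by lra.
exact: double_inj (congr1 (fun k : C => k p) ff').
Qed.

Lemma metricD h X Y Z : h X (Y + Z) = h X Y + h X Z.
Proof.
have [hl _] := riemannian_tensor h.
by have := hl X 1 Y Z; rewrite !scale1r.
Qed.

Lemma metric0 h X : h X 0 = 0.
Proof. by apply: (addrI (h X 0)); rewrite -metricD !addr0. Qed.

Lemma metricZ h f X Y : h X (f *: Y) = f * h X Y.
Proof.
have [hl _] := riemannian_tensor h.
by have := hl X f Y 0; rewrite addr0 metric0 addr0.
Qed.

Lemma metricN h X Y : h X (- Y) = - h X Y.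
Proof. by rewrite -scaleN1r metricZ mulN1r. Qed.

Lemma metricB h X Y Z : h X (Y - Z) = h X Y - h X Z.
Proof. by rewrite metricD metricN. Qed.

Lemma metricBl h X Y Z : h (X - Y) Z = h X Z - h Y Z.
Proof. by rewrite riemannian_sym metricB !(riemannian_sym h Z). Qed.

Lemma metric_definite h X : h X X = 0 -> X = 0.
Proof.
move=> hX0; apply/val_inj/funext => f; apply/val_inj/funext => p.
(* Either the tangent vector at [p] vanishes, hence kills [f], or positivity of [h] gives
   [0 < 0]. *)
have [/(congr1 (@^~ f))//|/riemannian_pos-/(_ h)] := eqVneq (tangent_at X p) 0.
by rewrite hX0 ltxx.
Qed.

(* Both sides say [w X *: Z = w Z *: X]. *)
Lemma metric_form_exchange h h' (w : {scalar vectorField M}) :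
    (forall X Y Z, w X * h Y Z = w Z * h Y X) ->
  forall X Y Z, w X * h' Y Z = w Z * h' Y X.
Proof.
move=> hw X Y Z; apply/eqP; rewrite -subr_eq0 -!metricZ -metricB.
suff -> : w X *: Z - w Z *: X = 0 by rewrite metric0.
by apply: (metric_definite (h := h)); rewrite metricB !metricZ hw subrr.
Qed.

End Metrics.

Section ConnectionDifference.
Variables (R : realType) (n : nat) (M : smoothManifold R n).
Local Notation C := (smoothFun M).
Implicit Types (g h : riemannianMetric M) (D : affineConnection M).
Implicit Types (X Y Z : vectorField M).

(** The Leibniz terms of the two connections are the same and cancel. *)
Lemma connection_diff_tensor D D' : tensor2 (connection_diff D' D).
Proof.
split=> [x f y z|y f x z]; rewrite /connection_diff.
  rewrite !nablaD !nabla_leibniz opprD addrACA [X in X - _ + _]addrC.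
  by rewrite addrKA scalerBr.
by rewrite !(nabla_linear _ _ _ x) scalerBr opprD addrACA.
Qed.

(** Both connections have the Lie bracket as antisymmetrization. *)
Lemma connection_diff_sym D D' : torsion_free D -> torsion_free D' ->
  forall X Y, connection_diff D' D X Y = connection_diff D' D Y X.
Proof.
have torsionE (D0 : affineConnection M) X Y :
    torsion_free D0 -> D0 X Y = D0 Y X + lie_bracket X Y.
  by move=> <-; rewrite addrC subrK.
move=> tD tD' X Y; rewrite /connection_diff (torsionE D') // (torsionE D) //.
by rewrite [D Y X + _]addrC addrKA.
Qed.

(** As [D] preserves [g], the derivative of [h] falls on [J] alone. *)
Lemma recurrent_metric_derivative g h D (J : {linear vectorField M -> vectorField M})
    (w : {scalar vectorField M}) :
    (forall X Y, h X Y = g X (J Y)) -> metric_compatible g D ->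
    recurrent_with D J w ->
  forall X Y Z, X (h Y Z) = h (D X Y) Z + h Y (D X Z) + w X * h Y Z.
Proof.
move=> hJ cD rJ X Y Z; rewrite !hJ cD -addrA -metricZ -metricD -rJ.
by rewrite /nabla_endo [J _ + _]addrC subrK.
Qed.

Lemma koszul_connection_diff h D D' (w : {scalar vectorField M}) :
    torsion_free D -> levi_civita h D' ->
    (forall X Y Z, X (h Y Z) = h (D X Y) Z + h Y (D X Z) + w X * h Y Z) ->
  forall X Y Z, let A := connection_diff D' D in
  h (A X Y) Z + h (A X Y) Z = w X * h Y Z + w Y * h X Z - w Z * h X Y.
Proof.
move=> tD [tD' cD'] Dh X Y Z A.
(* Since [D'] preserves [h], the defect of [D] is carried by [A]. *)
have E x y z : w x * h y z = h (A x y) z + h (A x z) y.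
  rewrite [h _ y]riemannian_sym /A /connection_diff metricB metricBl.
  by have := Dh x y z; rewrite cD' => /(canLR (addKr _)) <-; ring.
have S := connection_diff_sym tD tD'.
(* Of the six terms produced by [E], symmetry of [A] cancels four and makes the other two equal. *)
by rewrite !E [A Y X]S [A Z X]S [A Z Y]S; ring.
Qed.

End ConnectionDifference.

Theorem proposition2p5 (R : realType) (n : nat) (M : smoothManifold R n)
    (g g' : riemannianMetric M)
    (J : {linear vectorField M -> vectorField M})
    (hJ : forall X Y : vectorField M,
      g' X Y = g X (J Y) /\ g X (J Y) = g (J X) Y)
    (D D' : affineConnection M)
    (hD : levi_civita g D) (hD' : levi_civita g' D')
    (w : {scalar vectorField M}) (hw : recurrent_with D J w) :
  formal_frobenius g' (connection_diff D' D) <->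
  forall X Y Z : vectorField M, w X * g Y Z = w Z * g Y X.
Proof.
have [[tD cD] [tD' _]] := (hD, hD').
have g'J X Y : g' X Y = g X (J Y) by case: (hJ X Y).
have K := koszul_connection_diff tD hD' (recurrent_metric_derivative g'J cD hw).
set A := connection_diff D' D in K *.
(* Koszul's formula on both sides of the Frobenius identity: the [w Y] terms agree. Without
   subtractions, either implication is one cancellation. *)
have defect X Y Z : g' (A X Y) Z + g' (A X Y) Z + (w Z * g' Y X + w Z * g' Y X)
    = g' X (A Y Z) + g' X (A Y Z) + (w X * g' Y Z + w X * g' Y Z).
  rewrite [g' X (A _ _)]riemannian_sym !K.
  rewrite [g' Y X]riemannian_sym [g' Z X]riemannian_sym; ring.
split=> [[_ frob _]|wg].
  (* [defect] only speaks of [g'], so the condition is carried over from [g'] to [g]. *)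
  apply: (metric_form_exchange (h := g')) => X Y Z; apply: smoothFun_mulr2_inj.
  by have := defect X Y Z; rewrite frob => /addrI.
split=> [|X Y Z|]; first exact: connection_diff_tensor.
  apply: smoothFun_mulr2_inj; have := defect X Y Z.
  by rewrite (metric_form_exchange g' wg X Y Z) => /addIr.
exact: connection_diff_sym.
Qed.
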